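(* Let $G$ be a graph and let $M$ be a minimum maximal matching of $G$. If $M$ admits a dominating transversal, then $\gamma(G) \le |M| = \gamma_e(G)$.
   Context: Graphs are finite, simple and undirected. The domination number $\gamma(G)$ is the minimum size of a set $S$ of vertices such that every vertex outside $S$ has a neighbour in $S$. A matching is a set of edges no two of which share a vertex; it is maximal if no edge of $G$ can be added to it. The edge domination number $\gamma_e(G)$ is the minimum size of a maximal matching of $G$, and a minimum maximal matching is a maximal matching of that size. For a matching $M$, $V(M)$ is the set of vertices lying on edges of $M$; the other vertices are unsaturated by $M$. A transversal of $M$ is a set $T \subseteq V(M)$ containing exactly one endpoint of each edge of $M$. A transversal $T$ is dominating if every vertex of $G$ unsaturated by $M$ has a neighbour in $T$. *)

(* Defs.v *)
From mathcomp Require Import all_boot.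

Set Implicit Arguments.
Unset Strict Implicit.
Unset Printing Implicit Defensive.

(* A finite simple graph is a symmetric irreflexive
   relation e on a finType T; both properties are hypotheses of the theorem,
   since the definitions below make sense for any relation. *)
Section Graph.
Variables (T : finType) (e : rel T).
Implicit Types (S X A : {set T}) (M : {set {set T}}).

Definition edges : {set {set T}} :=
  [set A : {set T} | [exists x, exists y, e x y && (A == [set x; y])]].

Definition dominating S : bool :=
  [forall x, (x \notin S) ==> [exists y in S, e x y]].

Lemma dominating_card_ex :
  exists k, [exists S : {set T}, dominating S && (#|S| == k)].
Proof.
exists #|[set: T]|; apply/existsP; exists setT; rewrite eqxx andbT.
by apply/forallP=> x; rewrite inE.
Qed.

Definition domination_number : nat := ex_minn dominating_card_ex.

Definition matching M : bool := (M \subset edges) && trivIset M.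

Definition maximal_matching M : bool :=
  matching M && [forall A in edges, (A \notin M) ==> ~~ matching (A |: M)].

Lemma maximal_matching_card_ex :
  exists k, [exists M : {set {set T}}, maximal_matching M && (#|M| == k)].
Proof.
have m0 : matching set0.
  by rewrite /matching sub0set /trivIset /cover !big_set0 cards0.
have [M /maxsetP[mM maxM] _] := maxset_exists m0.
exists #|M|; apply/existsP; exists M; rewrite eqxx andbT /maximal_matching mM.
apply/forall_inP=> A _; apply/implyP=> AM; apply/negP=> mAM.
by move: AM; rewrite -(maxM _ mAM (subsetUr _ _)) setU11.
Qed.

Definition edge_domination_number : nat := ex_minn maximal_matching_card_ex.

Definition minimum_maximal_matching M : bool :=
  maximal_matching M && (#|M| == edge_domination_number).

(* V(M) is cover M. The library's is_transversal also asks that M be a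
   partition of cover M; this holds for every matching, whose edges are
   nonempty and pairwise disjoint. *)
Definition matching_transversal M X : bool := is_transversal X M (cover M).

Definition dominating_transversal M X : bool :=
  matching_transversal M X &&
  [forall x, (x \notin cover M) ==> [exists y in X, e x y]].

End Graph.

(* Main.v *)
Require Import Defs.
From mathcomp Require Import all_boot.

(** A dominating transversal [X] of [M] dominates the whole graph: unsaturated vertices have a
    neighbour in [X] by assumption, and a saturated vertex outside [X] is joined by its edge of [M]
    to the endpoint chosen in [X]. Since [X] has one vertex per edge of [M], it witnesses the bound
    [#|M|]. *)

(** Being distinct, [x] and [y] are the two ends of [A] in some order; symmetry of [e] covers the
    swapped order. *)
Lemma edge_adj (T : finType) (e : rel T) (A : {set T}) (x y : T) :
  symmetric e -> A \in edges e -> x \in A -> y \in A -> x != y -> e x y.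
Proof.
move=> e_sym; rewrite inE => /existsP[a /existsP[b /andP[eab /eqP->]]].
by move=> /set2P[]-> /set2P[]->; rewrite ?eqxx // e_sym.
Qed.

Lemma domination_number_le (T : finType) (e : rel T) (S : {set T}) :
  dominating e S -> domination_number e <= #|S|.
Proof.
move=> domS; rewrite /domination_number; case: ex_minnP => m _; apply.
by apply/existsP; exists S; rewrite domS eqxx.
Qed.

Lemma dominating_transversal_dominating (T : finType) (e : rel T)
    (M : {set {set T}}) (X : {set T}) :
  symmetric e -> M \subset edges e -> dominating_transversal e M X ->
  dominating e X.
Proof.
move=> e_sym /subsetP Me /andP[trX /forallP domX].
apply/forallP=> x; apply/implyP=> xX.
have [xM|xM] := boolP (x \in cover M); last exact: implyP (domX x) xM.
case/bigcupP: xM => A AM xA.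
(* [y] is the vertex that [X] selects on the edge [A]; it differs from [x] because [x] is outside
   [X]. *)
have [_ _ /forall_inP/(_ A AM)/cards1P[y defy]] := and3P trX.
have /setIP[yX yA] : y \in X :&: A by rewrite defy set11.
apply/existsP; exists y; rewrite yX /=.
apply: edge_adj (Me A AM) xA yA _ => //.
by apply: contraNneq xX => ->.
Qed.

Theorem proposition1 (T : finType) (e : rel T)
    (e_sym : symmetric e) (e_irr : irreflexive e)
    (M : {set {set T}})
    (minM : minimum_maximal_matching e M)
    (domM : exists X : {set T}, dominating_transversal e M X) :
  domination_number e <= #|M| /\ #|M| = edge_domination_number e.
Proof.
have /andP[/andP[/andP[Me _] _] /eqP cardM] := minM.
split=> //; have [X domX] := domM.
(* One vertex per edge, and the edges are disjoint, so [#|M|] becomes [#|X|]. *)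
have /andP[/card_transversal <- _] := domX.
apply: domination_number_le.
exact: dominating_transversal_dominating e_sym Me domX.
Qed.
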